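(* Let $f:V\to W$ be a linear map between (finite dimensional real) vector spaces endowed with linear generalized complex structures $L_V$ and $L_W$, respectively. Then the following assertions are equivalent: (i) $f$ is generalized complex linear. (ii) Up to linear $B$-field transformations (of $L_V$ and of $L_W$), $f$ is the direct sum of a complex linear map, between complex vector spaces, and a linear Poisson morphism, between symplectic vector spaces.
   Context: For $E\subseteq V^{\mathbb C}$ and $\varepsilon\in\Lambda^2E^*$, $L(E,\varepsilon)=\{u+\alpha\in V^{\mathbb C}\oplus(V^{\mathbb C})^*\mid u\in E,\ \alpha|_E=\varepsilon(u,\cdot)\}$. A linear generalized complex structure on a real vector space $V$ is a maximal isotropic subspace $L$ of $V^{\mathbb C}\oplus(V^{\mathbb C})^*$ (for $\langle u+\alpha,v+\beta\rangle=\tfrac12(\alpha(v)+\beta(u))$) with $L\cap\overline L=\{0\}$. Then $L=L(E,\varepsilon)$ for a unique pair, $E+\overline E=V^{\mathbb C}$ and the real two-form $\mathrm{Im}(\varepsilon|_{E\cap\overline E})$, on the real subspace of $V$ whose complexification is $E\cap\overline E$, is nondegenerate. The associated linear co-CR structure is $E$; the associated linear Poisson structure on $V$ is $L\bigl(E\cap\overline E,\mathrm{Im}(\varepsilon|_{E\cap\overline E})\bigr)$ (regarded on the underlying real subspace), which is the graph of a bivector on $V$. A linear map $f:V\to W$ is co-CR linear if $f(E_V)\subseteq E_W$ (for the complexification of $f$). It is a linear Poisson morphism if it maps the bivector of $V$ to the bivector of $W$. It is generalized complex linear if it is a co-CR linear Poisson morphism with respect to the associated linear co-CR and Poisson structures.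 A linear $B$-field transformation, given by a real two-form $b$ on $V$, is $\exp(b)(u+\alpha)=u+b(u,\cdot)+\alpha$, applied to $L$. A complex vector space $(V,J)$ has the linear generalized complex structure $L(V^{1,0},0)$ with $V^{1,0}$ the $\mathrm i$-eigenspace of $J$; a symplectic vector space $(V,\omega)$ has $L(V^{\mathbb C},\mathrm i\,\omega)$. Assertion (ii) means that there are real two-forms $b_V$, $b_W$ and decompositions $V=V'\oplus V''$, $W=W'\oplus W''$ such that $\exp(b_V)(L_V)$, $\exp(b_W)(L_W)$ are the direct sums of the structures of complex vector spaces on $V'$, $W'$ and symplectic vector spaces on $V''$, $W''$, and $f=f'\oplus f''$ with $f':V'\to W'$ complex linear and $f'':V''\to W''$ a linear Poisson morphism (factors may be zero). *)

(* Defs.v *)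
From HB Require Import structures.
From mathcomp Require Import all_boot all_order all_algebra.
From mathcomp Require Import reals.
From mathcomp Require Import complex ring.

Set Implicit Arguments.
Unset Strict Implicit.
Unset Printing Implicit Defensive.

Import Order.TTheory GRing.Theory Num.Theory.
Import VectorInternalTheory.

Local Open Scope ring_scope.
Local Open Scope complex_scope.

Section Forms.
Variable K : fieldType.

Lemma linfun_linE (U W : vectType K) (g : U -> W) : linear g -> linfun g =1 g.
Proof.
move=> lg; pose m := GRing.isLinear.Build K U W *:%R g lg.
pose h : {linear U -> W} := HB.pack g m.
exact: (lfunE h).
Qed.

Definition dual (U : vectType K) : vectType K := 'Hom(U, K^o).

Definition bilform (U : vectType K) : vectType K := 'Hom(U, dual U).

Definition two_form (U : vectType K) (b : bilform U) : Prop :=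
  forall u : U, b u u = 0.

Definition bilform_of (U : vectType K) (g : U -> U -> K) : bilform U :=
  linfun (fun u => linfun (g u : U -> K^o) : dual U).

Lemma bilform_ofE (U : vectType K) (g : U -> U -> K) :
    (forall a u u' v, g (a *: u + u') v = a * g u v + g u' v) ->
    (forall a u v v', g u (a *: v + v') = a * g u v + g u v') ->
  forall u v, bilform_of g u v = g u v.
Proof.
move=> gl gr u v.
have gE w : linfun (g w : U -> K^o) =1 g w.
  by apply: linfun_linE => a x y; rewrite gr.
rewrite /bilform_of linfun_linE ?gE // => a x y.
by apply/lfunP=> w; rewrite add_lfunE scale_lfunE !gE gl.
Qed.

Lemma bilformDZl (U : vectType K) (b : bilform U) a u u' v :
  b (a *: u + u') v = a * b u v + b u' v.
Proof. by rewrite linearP add_lfunE scale_lfunE. Qed.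

(* U + U^* *)
Definition gen (U : vectType K) : vectType K := (U * dual U)%type.

Definition pairing (U : vectType K) (x y : gen U) : K :=
  2%:R^-1 * (x.2 y.1 + y.2 x.1).

Definition isotropic (U : vectType K) (L : {vspace gen U}) : Prop :=
  forall x y, x \in L -> y \in L -> pairing x y = 0.

Definition maximal_isotropic (U : vectType K) (L : {vspace gen U}) : Prop :=
  isotropic L /\
  forall M : {vspace gen U}, isotropic M -> (L <= M)%VS -> M = L.

Definition restr_form (U : vectType K) (E : {vspace U}) (b : bilform U) :
    bilform (subvs_of E) :=
  bilform_of (fun u v : subvs_of E => b (vsval u) (vsval v)).

Lemma restr_formE (U : vectType K) (E : {vspace U}) (b : bilform U) u v :
  restr_form E b u v = b (vsval u) (vsval v).
Proof.
rewrite bilform_ofE // => a x y z.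
  by rewrite [vsval _]linearP bilformDZl.
by rewrite [vsval (_ + _)]linearP [LHS]linearP.
Qed.

Definition Lspace_eqn (U : vectType K) (E : {vspace U})
    (eps : bilform (subvs_of E)) (x : gen U) : dual (subvs_of E) :=
  (x.2 \o linfun (@vsval K U E))%VF - eps (vsproj E x.1).

(* L(E, eps), see mem_Lspace; vsproj E is only meaningful on E. *)
Definition Lspace (U : vectType K) (E : {vspace U})
    (eps : bilform (subvs_of E)) : {vspace gen U} :=
  (linfun (fst : gen U -> U) @^-1: E :&: lker (linfun (Lspace_eqn eps)))%VS.

Lemma mem_Lspace (U : vectType K) (E : {vspace U})
    (eps : bilform (subvs_of E)) (x : gen U) :
  x \in Lspace eps <->
  exists u : subvs_of E,
    x.1 = vsval u /\ forall v : subvs_of E, x.2 (vsval v) = eps u v.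
Proof.
have valE : linfun (@vsval K U E) =1 @vsval K U E by exact: lfunE.
have fstE : linfun (fst : gen U -> U) =1 fst by exact: lfunE.
have eqnE y v : Lspace_eqn eps y v = y.2 (vsval v) - eps (vsproj E y.1) v.
  by rewrite add_lfunE opp_lfunE comp_lfunE valE.
have eqn_lin : linfun (Lspace_eqn eps) =1 Lspace_eqn eps.
  apply: linfun_linE => a y z; apply/lfunP=> v.
  rewrite [RHS]add_lfunE scale_lfunE !eqnE /= add_lfunE scale_lfunE.
  by rewrite linearP bilformDZl scalerBr opprD addrACA.
rewrite /Lspace memv_cap -memv_preim memv_ker eqn_lin fstE.
split=> [/andP[xE /eqP/lfunP eq0]|[u [xu xE]]].
  exists (vsproj E x.1); rewrite vsprojK //; split=> // v.
  by apply/eqP; rewrite -subr_eq0 -eqnE eq0 lfunE.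
rewrite xu subvsP; apply/eqP/lfunP=> v.
by rewrite eqnE xE xu vsvalK subrr lfunE.
Qed.

Lemma Lspace_proj (U : vectType K) (E : {vspace U})
    (eps : bilform (subvs_of E)) (u : U) :
  u \in E <-> exists alpha : dual U, ((u, alpha) : gen U) \in Lspace eps.
Proof.
split=> [uE|[alpha /mem_Lspace[v [/= -> _]]]]; last exact: subvsP.
have projE : linfun (vsproj E) =1 vsproj E by exact: lfunE.
exists (eps (vsproj E u) \o linfun (vsproj E))%VF.
apply/mem_Lspace; exists (vsproj E u); rewrite vsprojK //; split=> // v.
by rewrite comp_lfunE projE vsvalK.
Qed.

Lemma Lspace_inj_base (U : vectType K) (E1 E2 : {vspace U})
    (eps1 : bilform (subvs_of E1)) (eps2 : bilform (subvs_of E2)) :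
  Lspace eps1 = Lspace eps2 -> E1 = E2.
Proof.
move=> e12; apply/vspaceP=> u; apply/idP/idP.
  by move/(Lspace_proj eps1); rewrite e12 => /(Lspace_proj eps2).
by move/(Lspace_proj eps2); rewrite -e12 => /(Lspace_proj eps1).
Qed.

Lemma Lspace_inj (U : vectType K) (E : {vspace U}) :
  injective (@Lspace U E).
Proof.
move=> eps1 eps2 e12; apply/lfunP=> u; apply/lfunP=> v.
have /(Lspace_proj eps1)[alpha aL] := subvsP u.
have /mem_Lspace[u1 [/val_inj <- <-]] := aL.
by have := aL; rewrite e12 => /mem_Lspace[u2 [/val_inj <- <-]].
Qed.

Lemma two_formC (U : vectType K) (b : bilform U) u v :
  two_form b -> b u v = - b v u.
Proof.
move=> b0; apply/eqP; rewrite -addr_eq0; apply/eqP.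
have := b0 (1 *: u + v).
rewrite bilformDZl mul1r scale1r [b u _]linearD [b v _]linearD /= !b0.
by rewrite add0r addr0.
Qed.

Lemma maximal_isotropicE (U : vectType K) (L : {vspace gen U}) :
    2%:R != 0 :> K -> maximal_isotropic L ->
  exists (E : {vspace U}) (eps : bilform (subvs_of E)),
    two_form eps /\ L = Lspace eps.
Proof.
move=> two0 [isoL maxL].
have iso0 x y : x \in L -> y \in L -> x.2 y.1 + y.2 x.1 = 0.
  by move=> xL yL; have /eqP := isoL x y xL yL;
     rewrite mulf_eq0 invr_eq0 (negPf two0) => /eqP.
pose g : 'Hom(subvs_of L, U) :=
  (linfun (fst : gen U -> U) \o linfun (@vsval K _ L))%VF.
have gE x : g x = (vsval x).1 by rewrite comp_lfunE !lfunE.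
pose E := limg g.
pose s (u : U) : gen U := vsval (g^-1%VF u).
have sL u : s u \in L by exact: subvsP.
have s1 u : u \in E -> (s u).1 = u.
  by move=> uE; rewrite -gE limg_lfunVK.
have LE x : x \in L -> x.1 \in E.
  by move=> xL; rewrite -(vsprojK xL) -gE memv_img ?memvf.
have sP a u v : s (a *: u + v) = a *: s u + s v by rewrite /s linearP.
pose eps : bilform (subvs_of E) :=
  bilform_of (fun u v => (s (vsval u)).2 (vsval v)).
have epsE u v : eps u v = (s (vsval u)).2 (vsval v).
  rewrite bilform_ofE // => a x y z; last by rewrite [LHS]linearP.
  by rewrite [vsval _]linearP sP add_lfunE scale_lfunE.
have eps0 : two_form eps.
  move=> u; rewrite epsE; have := iso0 _ _ (sL (vsval u)) (sL (vsval u)).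
  rewrite s1 ?subvsP // -mulr2n -mulr_natl => /eqP.
  by rewrite mulf_eq0 (negPf two0) => /eqP.
exists E, eps; split=> //; apply/esym/maxL.
  move=> x y /mem_Lspace[u [xu xE]] /mem_Lspace[v [yv yE]].
  by rewrite /pairing xu yv xE yE (two_formC _ _ eps0) addNr mulr0.
apply/subvP=> x xL; apply/mem_Lspace; exists (vsproj E x.1).
rewrite vsprojK ?LE //; split=> // v; rewrite epsE vsprojK ?LE //.
have := iso0 _ _ xL (sL (vsval v)); have := iso0 _ _ (sL x.1) (sL (vsval v)).
rewrite !s1 ?subvsP ?LE // => /eqP; rewrite addr_eq0 => /eqP->.
by move/eqP; rewrite addr_eq0 => /eqP.
Qed.

Definition exp_fun (U : vectType K) (b : bilform U) (x : gen U) : gen U :=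
  (x.1, b x.1 + x.2).

Definition exp_form (U : vectType K) (b : bilform U) : 'End(gen U) :=
  linfun (exp_fun b).

Lemma exp_formE (U : vectType K) (b : bilform U) x :
  exp_form b x = (x.1, b x.1 + x.2).
Proof.
apply: linfun_linE => a y z; rewrite /exp_fun /=.
by congr (_, _); rewrite /= linearP scalerDr addrACA.
Qed.

(* A bivector is encoded by the associated skew map U^* -> U. *)
Definition bivector (U : vectType K) (pi : 'Hom(dual U, U)) : Prop :=
  forall alpha : dual U, alpha (pi alpha) = 0.

Definition graph_of (U : vectType K) (P : {vspace gen U})
    (pi : 'Hom(dual U, U)) : Prop :=
  forall (u : U) (alpha : dual U), (u, alpha) \in P <-> u = pi alpha.

Definition transpose (U W : vectType K) (f : 'Hom(U, W)) :
    'Hom(dual W, dual U) :=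
  linfun (fun beta : dual W => (beta \o f)%VF : dual U).

Lemma transposeE (U W : vectType K) (f : 'Hom(U, W)) beta u :
  transpose f beta u = beta (f u).
Proof.
rewrite linfun_linE ?comp_lfunE // => a x y.
by apply/lfunP=> v; rewrite !(comp_lfunE, add_lfunE, scale_lfunE).
Qed.

(* The image of pi under Lambda^2 f, in the encoding of bivector. *)
Definition push_bivector (U W : vectType K) (f : 'Hom(U, W))
    (pi : 'Hom(dual U, U)) : 'Hom(dual W, W) :=
  (f \o (pi \o transpose f))%VF.

End Forms.

Section Complexification.
Variable R : realType.

(* V^C, with (x, y) standing for x + i y. *)
Definition cplx (V : vectType R) : Type := (V * V)%type.

Section Structure.
Variable V : vectType R.

HB.instance Definition _ := GRing.Zmodule.copy (cplx V) (V * V)%type.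

Definition cplx_scale (c : R[i]) (z : cplx V) : cplx V :=
  (complex.Re c *: z.1 - complex.Im c *: z.2,
   complex.Re c *: z.2 + complex.Im c *: z.1).

Fact cplx_scaleA c d z : cplx_scale c (cplx_scale d z) = cplx_scale (c * d) z.
Proof.
case: c d z => [a b] [c d] [x y]; congr pair => /=.
  rewrite scalerBr scalerDr !scalerA scalerBl scalerDl !opprD -!addrA.
  by congr (_ + _); rewrite addrA addrC.
rewrite scalerDr scalerBr !scalerA !scalerDl scaleNr -!addrA.
by congr (_ + _); rewrite addrA addrC.
Qed.

Fact cplx_scale1 : left_id 1 cplx_scale.
Proof.
by case=> x y; rewrite /cplx_scale /= !scale1r !scale0r subr0 addr0.
Qed.

Fact cplx_scaleDr : right_distributive cplx_scale +%R.
Proof.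
case=> a b [x y] [z t]; rewrite /cplx_scale; congr pair => /=.
  by rewrite !scalerDr opprD addrACA.
by rewrite !scalerDr addrACA.
Qed.

Fact cplx_scaleDl z : {morph cplx_scale^~ z : c d / c + d}.
Proof.
case: z => x y [a b] [c d]; rewrite /cplx_scale; congr pair => /=.
  by rewrite !scalerDl opprD addrACA.
by rewrite !scalerDl addrACA.
Qed.

HB.instance Definition _ := GRing.Zmodule_isLmodule.Build R[i] (cplx V)
  cplx_scaleA cplx_scale1 cplx_scaleDr cplx_scaleDl.

Lemma cplx_scaleE (c : R[i]) (z : cplx V) :
  c *: z = (complex.Re c *: z.1 - complex.Im c *: z.2,
            complex.Re c *: z.2 + complex.Im c *: z.1).
Proof. by []. Qed.

Fact cplx_vect_iso : Vector.axiom (dim V) (cplx V).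
Proof.
exists (fun z : cplx V => \row_j (v2r z.1 0 j +i* v2r z.2 0 j)).
  move=> [a b] [x y] [z t]; apply/rowP=> j; rewrite !mxE.
  apply/eqP; rewrite eq_complex /= !(linearD, linearN, linearZ) /= !mxE mulrN.
  by rewrite !eqxx.
exists (fun r : 'rV[R[i]]_(dim V) =>
  (r2v (\row_j complex.Re (r 0 j)), r2v (\row_j complex.Im (r 0 j))) : cplx V).
  move=> [x y]; congr pair; rewrite -[RHS]v2rK; congr r2v;
    by apply/rowP=> j; rewrite !mxE.
move=> r; apply/rowP=> j; rewrite !mxE /= !r2vK !mxE.
by case: (r 0 j).
Qed.

HB.instance Definition _ :=
  Lmodule_hasFinDim.Build R[i] (cplx V) cplx_vect_iso.

Definition real_vec (v : V) : cplx V := (v, 0).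

Definition conjv (z : cplx V) : cplx V := (z.1, - z.2).

Lemma conjvK : involutive conjv.
Proof. by case=> x y; rewrite /conjv /= opprK. Qed.

Lemma conjvP c (y z : cplx V) :
  conjv (c *: y + z) = conjc c *: conjv y + conjv z.
Proof.
case: c y z => a b [x y] [z t]; rewrite /conjv; congr pair => /=.
  by rewrite scaleNr scalerN opprK.
by rewrite scalerN scaleNr !opprD.
Qed.

End Structure.

Definition cplx_map_fun (V W : vectType R) (f : 'Hom(V, W)) (z : cplx V) :
  cplx W := (f z.1, f z.2).

Definition cplx_map (V W : vectType R) (f : 'Hom(V, W)) :
  'Hom(cplx V, cplx W) := linfun (cplx_map_fun f).

Lemma cplx_mapE (V W : vectType R) (f : 'Hom(V, W)) z :
  cplx_map f z = (f z.1, f z.2).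
Proof.
apply: linfun_linE => -[a b] [x y] [z' t]; rewrite /cplx_map_fun.
by congr pair => /=; rewrite !(linearD, linearN, linearZ).
Qed.

Definition cplx_form_fun (V : vectType R) (b : bilform V) (y z : cplx V) :
    R[i] :=
  (b y.1 z.1 - b y.2 z.2) +i* (b y.1 z.2 + b y.2 z.1).

Definition cplx_form (V : vectType R) (b : bilform V) : bilform (cplx V) :=
  bilform_of (cplx_form_fun b).

Lemma cplx_formE (V : vectType R) (b : bilform V) y z :
  cplx_form b y z = (b y.1 z.1 - b y.2 z.2) +i* (b y.1 z.2 + b y.2 z.1).
Proof.
rewrite /cplx_form bilform_ofE //.
  move=> [c d] [x x'] [u u'] [v v']; apply/eqP; rewrite eq_complex /=.
  rewrite !(linearD, linearN, linearZ) /=.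
  rewrite !(add_lfunE, opp_lfunE, scale_lfunE) /=.
  rewrite -![_ *: _]/(_ * _).
  by apply/andP; split; apply/eqP; ring.
move=> [c d] [x x'] [u u'] [v v']; apply/eqP; rewrite eq_complex /=.
rewrite !(linearD, linearN, linearZ) /=.
rewrite -![_ *: _]/(_ * _).
by apply/andP; split; apply/eqP; ring.
Qed.

Definition conj_dual_fun (V : vectType R) (alpha : dual (cplx V))
    (z : cplx V) : R[i]^o := conjc (alpha (conjv z)).

Definition conj_dual (V : vectType R) (alpha : dual (cplx V)) :
    dual (cplx V) := linfun (conj_dual_fun alpha).

Lemma conj_dualE (V : vectType R) (alpha : dual (cplx V)) z :
  conj_dual alpha z = conjc (alpha (conjv z)).
Proof.
apply: linfun_linE => c x y; rewrite /conj_dual_fun conjvP linearP.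
by rewrite -![_ *: _]/(_ * _) rmorphD rmorphM /= conjcK.
Qed.

Definition conj_gen (V : vectType R) (x : gen (cplx V)) : gen (cplx V) :=
  (conjv x.1, conj_dual x.2).

Lemma conj_genK (V : vectType R) : involutive (@conj_gen V).
Proof.
case=> z alpha; rewrite /conj_gen /= conjvK; congr pair.
by apply/lfunP=> y; rewrite !conj_dualE conjvK conjcK.
Qed.

Lemma conj_genP (V : vectType R) c (x y : gen (cplx V)) :
  conj_gen (c *: x + y) = conjc c *: conj_gen x + conj_gen y.
Proof.
case: x y => x alpha [y beta]; rewrite /conj_gen /= conjvP; congr pair.
apply/lfunP=> z; rewrite add_lfunE scale_lfunE !conj_dualE.
by rewrite add_lfunE scale_lfunE -![_ *: _]/(_ * _) rmorphD rmorphM.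
Qed.

(* Image of a subspace under an antilinear involution c. *)
Definition conj_space (U : vectType R[i]) (c : U -> U) (L : {vspace U}) :
    {vspace U} := <<[seq c x | x <- vbasis L]>>%VS.

Lemma mem_conj_space (U : vectType R[i]) (c : U -> U) (L : {vspace U}) x :
    involutive c -> (forall a y z, c (a *: y + z) = conjc a *: c y + c z) ->
  (x \in conj_space c L) = (c x \in L).
Proof.
move=> cK cP.
have c0 : c 0 = 0.
  by apply: (addrI (c 0)); have := cP 1 0 0;
     rewrite scaler0 !addr0 conjc1 scale1r => <-.
have sub (s : seq U) y : y \in <<s>>%VS -> c y \in <<map c s>>%VS.
  elim: s y => [|z s IHs] y /=.
    by rewrite span_nil !memv0 => /eqP->; rewrite c0.
  rewrite !span_cons => /memv_addP[_ /vlineP[a ->] [t ts ->]].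
  by rewrite cP memv_add ?memvZ ?memv_line ?IHs.
rewrite /conj_space; apply/idP/idP => [/sub|].
  by rewrite -map_comp (eq_map (g := id)) ?map_id ?(span_basis (vbasisP L)).
by rewrite -{1}(span_basis (vbasisP L)) => /sub; rewrite cK.
Qed.

(* D^C, for a real subspace D of V. *)
Definition cplx_space (V : vectType R) (D : {vspace V}) : {vspace cplx V} :=
  limg (cplx_map (linfun (@vsval R V D))).

Lemma mem_cplx_space (V : vectType R) (D : {vspace V}) (z : cplx V) :
  (z \in cplx_space D) = (z.1 \in D) && (z.2 \in D).
Proof.
apply/memv_imgP/andP => [[y _ ->]|[z1 z2]].
  by rewrite cplx_mapE /= !lfunE /= !subvsP.
exists (vsproj D z.1, vsproj D z.2); rewrite ?memvf // cplx_mapE /= !lfunE /=.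
by rewrite !vsprojK //; case: z {z1 z2}.
Qed.

Definition generalized_complex (V : vectType R)
    (L : {vspace gen (cplx V)}) : Prop :=
  maximal_isotropic L /\ (L :&: conj_space (@conj_gen V) L = 0)%VS.

(* E is determined by L, and exists when L is maximal isotropic: see
   Lspace_inj_base and maximal_isotropicE. *)
Definition assoc_coCR (V : vectType R) (L : {vspace gen (cplx V)})
    (E : {vspace cplx V}) : Prop :=
  exists eps : bilform (subvs_of E), two_form eps /\ L = Lspace eps.

(* Im(eps) restricted to D; meaningful when D is contained in E. *)
Definition im_form (V : vectType R) (E : {vspace cplx V})
    (eps : bilform (subvs_of E)) (D : {vspace V}) : bilform (subvs_of D) :=
  bilform_of (fun u v : subvs_of D =>
    complex.Im (eps (vsproj E (real_vec (vsval u)))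
                    (vsproj E (real_vec (vsval v))))).

Lemma im_formE (V : vectType R) (E : {vspace cplx V})
    (eps : bilform (subvs_of E)) (D : {vspace V}) u v :
  im_form eps D u v =
    complex.Im (eps (vsproj E (real_vec (vsval u)))
                    (vsproj E (real_vec (vsval v)))).
Proof.
have rvP a (x y : subvs_of D) : vsproj E (real_vec (vsval (a *: x + y))) =
    a%:C *: vsproj E (real_vec (vsval x)) + vsproj E (real_vec (vsval y)).
  rewrite -linearP; congr vsproj; congr pair => /=.
    by rewrite scaler0 subr0.
  by rewrite scaler0 scale0r !addr0.
have ImP a (y z : R[i]) :
    complex.Im (a%:C * y + z) = a * complex.Im y + complex.Im z.
  by case: y z => [y y'] [z z'] /=; rewrite mul0r addr0.
rewrite /im_form bilform_ofE // => a x y z; rewrite rvP -ImP.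
  by rewrite bilformDZl.
by rewrite [in LHS]linearP.
Qed.

Definition assoc_Poisson (V : vectType R) (L : {vspace gen (cplx V)})
    (P : {vspace gen V}) : Prop :=
  exists (E : {vspace cplx V}) (eps : bilform (subvs_of E)) (D : {vspace V}),
    [/\ two_form eps, L = Lspace eps,
        cplx_space D = (E :&: conj_space (@conjv V) E)%VS
      & P = Lspace (im_form eps D)].

Definition coCR_linear (V W : vectType R) (f : 'Hom(V, W))
    (EV : {vspace cplx V}) (EW : {vspace cplx W}) : Prop :=
  (cplx_map f @: EV <= EW)%VS.

Definition Poisson_morphism (V W : vectType R) (f : 'Hom(V, W))
    (PV : {vspace gen V}) (PW : {vspace gen W}) : Prop :=
  exists (piV : 'Hom(dual V, V)) (piW : 'Hom(dual W, W)),
    [/\ bivector piV /\ graph_of PV piV, bivector piW /\ graph_of PW piW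
      & push_bivector f piV = piW].

Definition gen_coCR_linear (V W : vectType R) (f : 'Hom(V, W))
    (LV : {vspace gen (cplx V)}) (LW : {vspace gen (cplx W)}) : Prop :=
  exists EV EW,
    [/\ assoc_coCR LV EV, assoc_coCR LW EW & coCR_linear f EV EW].

Definition gen_Poisson_morphism (V W : vectType R) (f : 'Hom(V, W))
    (LV : {vspace gen (cplx V)}) (LW : {vspace gen (cplx W)}) : Prop :=
  exists PV PW,
    [/\ assoc_Poisson LV PV, assoc_Poisson LW PW & Poisson_morphism f PV PW].

Definition generalized_complex_linear (V W : vectType R) (f : 'Hom(V, W))
    (LV : {vspace gen (cplx V)}) (LW : {vspace gen (cplx W)}) : Prop :=
  gen_coCR_linear f LV LW /\ gen_Poisson_morphism f LV LW.

Definition B_transform (V : vectType R) (b : bilform V)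
    (L : {vspace gen (cplx V)}) : {vspace gen (cplx V)} :=
  (exp_form (cplx_form b) @: L)%VS.

Definition complex_structure (V : vectType R) (J : 'End(V)) : Prop :=
  forall v, J (J v) = - v.

Definition symplectic_form (V : vectType R) (w : bilform V) : Prop :=
  two_form w /\ forall u, (forall v, w u v = 0) -> u = 0.

Definition L_complex (V : vectType R) (J : 'End(V)) :
    {vspace gen (cplx V)} :=
  Lspace (0 : bilform (subvs_of (passmx.leigenspace (cplx_map J) 'i))).

Definition L_symplectic (V : vectType R) (w : bilform V) :
    {vspace gen (cplx V)} :=
  Lspace (restr_form fullv ('i *: cplx_form w)).

Definition complex_linear (V W : vectType R) (JV : 'End(V)) (JW : 'End(W))
    (f : 'Hom(V, W)) : Prop :=
  forall v, f (JV v) = JW (f v).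

Definition decomposition (V : vectType R) (V1 V2 : {vspace V}) : Prop :=
  (V1 + V2 = fullv)%VS /\ (V1 :&: V2 = 0)%VS.

Definition incl (V : vectType R) (V1 : {vspace V}) : 'Hom(subvs_of V1, V) :=
  linfun (@vsval R V V1).

(* L is the direct sum of L1 and L2 along V = V1 + V2: here V^C is identified
   with V1^C + V2^C, and its dual with the sum of the duals by restriction. *)
Definition direct_sum (V : vectType R) (V1 V2 : {vspace V})
    (L : {vspace gen (cplx V)})
    (L1 : {vspace gen (cplx (subvs_of V1))})
    (L2 : {vspace gen (cplx (subvs_of V2))}) : Prop :=
  decomposition V1 V2 /\
  forall (u1 : cplx (subvs_of V1)) (u2 : cplx (subvs_of V2))
      (alpha : dual (cplx V)),
    ((cplx_map (incl V1) u1 + cplx_map (incl V2) u2, alpha) \in L) =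
    ((u1, transpose (cplx_map (incl V1)) alpha) \in L1) &&
    ((u2, transpose (cplx_map (incl V2)) alpha) \in L2).

Definition direct_sum_map (V W : vectType R) (V1 V2 : {vspace V})
    (W1 W2 : {vspace W}) (f : 'Hom(V, W))
    (f1 : 'Hom(subvs_of V1, subvs_of W1))
    (f2 : 'Hom(subvs_of V2, subvs_of W2)) : Prop :=
  forall (u1 : subvs_of V1) (u2 : subvs_of V2),
    f (vsval u1 + vsval u2) = vsval (f1 u1) + vsval (f2 u2).

End Complexification.

(* Main.v *)
Require Import Defs.
From mathcomp Require Import all_boot all_order all_algebra.
From mathcomp Require Import reals complex ring.

(* Write L = L(E, eps), let D be the real part of E :&: conj E, and
   w = Im (eps|_D). For any complement V1 of D, the space E is the sum of D^C
   and of E :&: V1^C, and since E + conj E = V^C the latter is the holomorphic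
   space of a complex structure on V1. A real two-form on V whose restriction
   to E is i w - eps then transforms L into the direct sum of the structures of
   V1 and of (D, w). Conversely such a splitting determines E, D and w. The
   Poisson bivector is the push-forward of w^-1 along the inclusion of D, so f
   is a Poisson morphism if and only if its restriction D_V -> D_W is one.
   When f is generalized complex linear, f D_V = D_W; hence for any complement
   W1 of D_W the preimage of W1 contains a complement of D_V, on which f is
   complex linear. *)

Set Implicit Arguments.
Unset Strict Implicit.
Unset Printing Implicit Defensive.

Import Order.TTheory GRing.Theory Num.Theory.
Import VectorInternalTheory.

Local Open Scope ring_scope.
Local Open Scope complex_scope.

(** * Functionals and bilinear forms over a field *)

Lemma exists_functional (K : fieldType) (U : vectType K) (A : {vspace U}) u :
  u \notin A ->
  exists alpha : dual U, alpha u != 0 /\ {in A, forall v, alpha v = 0}.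
Proof.
(* The kernel of [g] is [A], so some coordinate of [g u] is nonzero and separates [u] from [A]. *)
move=> uA; pose g : 'End(U) := (\1 - projv A)%VF.
have gE v : g v = v - projv A v by rewrite add_lfunE opp_lfunE id_lfunE.
have [j uj] : exists j, v2r (g u) 0 j != 0.
  apply/existsP; apply: contraNT uA => /existsPn/= u0.
  suff /(congr1 r2v): v2r (g u) = 0.
    by rewrite v2rK linear0 gE => /subr0_eq ->; exact: memv_proj.
  by apply/rowP => j; rewrite mxE; apply/eqP; move: (u0 j); rewrite negbK.
exists (linfun (fun v : U => v2r (g v) 0 j : K^o)).
have fE : linfun (fun v : U => v2r (g v) 0 j : K^o) =1
    (fun v : U => v2r (g v) 0 j : K^o).
  by apply: linfun_linE => a x y; rewrite !linearP !mxE.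
rewrite fE; split=> // v vA.
by rewrite fE gE projv_id // subrr linear0 mxE.
Qed.

Lemma dim_dual (K : fieldType) (U : vectType K) :
  \dim {:dual U} = \dim {:U}.
Proof. by rewrite !dimvf; exact: muln1. Qed.

Lemma bilformDZr (K : fieldType) (U : vectType K) (b : bilform U) a u v v' :
  b u (a *: v + v') = a * b u v + b u v'.
Proof. by rewrite linearP. Qed.

Lemma bilform0l (K : fieldType) (U : vectType K) (b : bilform U) v :
  b 0 v = 0.
Proof. by rewrite linear0 lfunE. Qed.

Lemma bilform0r (K : fieldType) (U : vectType K) (b : bilform U) u :
  b u 0 = 0.
Proof. by rewrite linear0. Qed.

Lemma mem_LspaceE (K : fieldType) (U : vectType K) (E : {vspace U})
    (eps : bilform (subvs_of E)) (x : gen U) :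
  x \in Lspace eps <->
  x.1 \in E /\ {in E, forall v, x.2 v = eps (vsproj E x.1) (vsproj E v)}.
Proof.
rewrite mem_Lspace; split=> [[u [-> xE]]|[xE h]].
  by rewrite subvsP; split=> // v vE; rewrite -[in LHS](vsprojK vE) xE vsvalK.
exists (vsproj E x.1); rewrite vsprojK //; split=> // v.
by rewrite h ?subvsP // vsvalK.
Qed.

Lemma inclE (K : fieldType) (U : vectType K) (A : {vspace U}) u :
  linfun (@vsval K U A) u = vsval u.
Proof. exact: lfunE. Qed.

(** * Projections of a direct sum decomposition *)

Section Decomposition.
Variables (R : realType) (V : vectType R) (V1 V2 : {vspace V}).
Hypothesis dec : decomposition V1 V2.

Definition dec_proj1 : 'Hom(V, subvs_of V1) :=
  (linfun (vsproj V1) \o daddv_pi V1 V2)%VF.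
Definition dec_proj2 : 'Hom(V, subvs_of V2) :=
  (linfun (vsproj V2) \o daddv_pi V2 V1)%VF.

Lemma incl_proj v : incl V1 (dec_proj1 v) + incl V2 (dec_proj2 v) = v.
Proof.
case: dec => dD dI; rewrite !inclE !comp_lfunE !lfunE /=.
by rewrite !vsprojK ?memv_pi // daddv_pi_add // dD memvf.
Qed.

(** Two decompositions of one vector differ by an element of V1 and V2 at once, hence by 0. *)
Lemma proj_incl u1 u2 :
  dec_proj1 (incl V1 u1 + incl V2 u2) = u1 /\
  dec_proj2 (incl V1 u1 + incl V2 u2) = u2.
Proof.
have := incl_proj (incl V1 u1 + incl V2 u2).
set p := dec_proj1 _; set q := dec_proj2 _; rewrite !inclE => h.
have e : vsval (p - u1) = vsval (u2 - q).
  by rewrite !linearB /=; apply/eqP; rewrite subr_eq addrAC eq_sym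
    subr_eq h addrC.
have : vsval (p - u1) \in (V1 :&: V2)%VS.
  by rewrite memv_cap subvsP e subvsP.
case: dec => _ ->; rewrite memv0 => /eqP z; split.
  by apply/subr0_eq/subvs_inj; rewrite z linear0.
by apply/esym/subr0_eq/subvs_inj; rewrite -e z linear0.
Qed.

End Decomposition.

(** * Poisson bivectors *)

Lemma bivector_push (K : fieldType) (U W : vectType K) (f : 'Hom(U, W)) pi :
  bivector pi -> bivector (push_bivector f pi).
Proof.
move=> bpi alpha; rewrite /push_bivector !comp_lfunE -(transposeE f).
exact: bpi.
Qed.

Lemma push_bivector_comp (K : fieldType) (U V W : vectType K)
    (g : 'Hom(V, W)) (f : 'Hom(U, V)) pi :
  push_bivector (g \o f) pi = push_bivector g (push_bivector f pi).
Proof.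
apply/lfunP=> alpha; rewrite !comp_lfunE; do 3!congr (fun_of_lfun _ _).
by apply/lfunP=> u; rewrite !transposeE comp_lfunE.
Qed.

(** Functionals on [A] extend to [U], so the transpose of the inclusion is onto, while the inclusion
    is injective. *)
Lemma push_incl_inj (K : fieldType) (U : vectType K) (A : {vspace U}) :
  injective (push_bivector (linfun (@vsval K U A))).
Proof.
move=> pi pi' e; apply/lfunP=> alpha; apply: subvs_inj.
have vE : linfun (vsproj A) =1 vsproj A by exact: lfunE.
pose beta : dual U := (alpha \o linfun (vsproj A))%VF.
have bE : transpose (linfun (@vsval K U A)) beta = alpha.
  by apply/lfunP=> u; rewrite transposeE inclE comp_lfunE vE vsvalK.
by have := congr1 (fun h => fun_of_lfun h beta) e;
  rewrite !comp_lfunE !inclE bE.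
Qed.

Section Poisson.
Variable R : realType.

Section Symplectic.
Variables (U : vectType R) (w : bilform U).
Hypothesis sw : symplectic_form w.

Lemma symplectic_ker : lker w == 0%VS.
Proof.
apply/lker0P => u v e; apply/subr0_eq; case: sw => _; apply => x.
by rewrite linearB /= e subrr lfunE.
Qed.

Lemma symplecticK : cancel w (w^-1)%VF.
Proof. exact: lker0_lfunK symplectic_ker. Qed.

(** Nondegeneracy makes [w] injective, and a space and its dual have the same dimension. *)
Lemma symplecticVK : cancel (w^-1)%VF w.
Proof.
move=> alpha; apply: limg_lfunVK; suff -> : limg w = fullv by exact: memvf.
have wI : (fullv :&: lker w)%VS = 0%VS by rewrite (eqP symplectic_ker) capv0.
by apply/eqP; rewrite eqEdim subvf /= (limg_dim_eq wI) dim_dual.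
Qed.

Lemma symplectic_bivector : bivector (w^-1)%VF.
Proof.
by move=> alpha; rewrite -{1}(symplecticVK alpha); case: sw => w0 _; exact: w0.
Qed.

End Symplectic.

Lemma im_form_two_form (V : vectType R) (E : {vspace cplx V})
    (eps : bilform (subvs_of E)) D :
  two_form eps -> two_form (im_form eps D).
Proof. by move=> e0 u; rewrite im_formE e0. Qed.

Lemma cplx_space_inj (V : vectType R) : injective (@cplx_space R V).
Proof.
move=> D D' e; apply/vspaceP => v.
have := mem_cplx_space D (real_vec v); rewrite e mem_cplx_space /=.
by rewrite !mem0v !andbT.
Qed.

(** The relation [assoc_Poisson] is functional: L determines E and eps, and E determines D. *)
Lemma assoc_Poisson_inj (V : vectType R) (L : {vspace gen (cplx V)}) P P' :
  assoc_Poisson L P -> assoc_Poisson L P' -> P = P'.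
Proof.
case=> [E [eps [D [_ -> DE ->]]]] [E' [eps' [D' [_ LE' DE' ->]]]].
have eE := Lspace_inj_base LE'.
(* The type of [eps'] depends on [E'], so the bases are identified before the forms are compared. *)
case: _ / eE in eps' LE' DE' *; have eeps := Lspace_inj LE'; subst eps'.
by have eD : D = D' by [apply: cplx_space_inj; rewrite DE DE']; subst D'.
Qed.

Definition has_bivector (V : vectType R) (L : {vspace gen (cplx V)})
    (pi : 'Hom(dual V, V)) : Prop :=
  exists P, assoc_Poisson L P /\ (bivector pi /\ graph_of P pi).

(** Uniqueness of the Poisson structure and of its bivector turns the existential definition into an
    equation between given bivectors. *)
Lemma gen_Poisson_morphismE (V W : vectType R) (f : 'Hom(V, W)) LV LW piV piW :
  has_bivector LV piV -> has_bivector LW piW ->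
  gen_Poisson_morphism f LV LW <-> push_bivector f piV = piW.
Proof.
move=> [PV [aV gV]] [PW [aW gW]]; split; last first.
  by move=> e; exists PV, PW; split=> //; exists piV, piW.
move=> [PV' [PW' [aV' aW' [piV' [piW' [[_ gV'] [_ gW'] e]]]]]].
have graph_inj (U : vectType R) (P : {vspace gen U}) pi pi' :
    graph_of P pi -> graph_of P pi' -> pi = pi'.
  by move=> g g'; apply/lfunP => a; apply/(g' _ a)/g.
case: gV gW => [_ gV] [_ gW].
rewrite (assoc_Poisson_inj aV' aV) in gV'.
rewrite (assoc_Poisson_inj aW' aW) in gW'.
by rewrite (graph_inj _ _ _ _ gV gV') (graph_inj _ _ _ _ gW gW').
Qed.

(** Membership of (u, alpha) means that u lies in D and w u is the restriction of alpha to D;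
    solving for u gives the inverse of w applied to that restriction. *)
Lemma graph_of_Lspace (V : vectType R) (D : {vspace V})
    (w : bilform (subvs_of D)) :
  symplectic_form w ->
  graph_of (Lspace w) (push_bivector (incl D) (w^-1)%VF).
Proof.
move=> sw u alpha; rewrite mem_Lspace !comp_lfunE inclE /=.
have -> : (exists u0 : subvs_of D, u = vsval u0 /\
    forall v : subvs_of D, alpha (vsval v) = w u0 v) <->
    exists u0 : subvs_of D, u = vsval u0 /\ transpose (incl D) alpha = w u0.
  split=> -[u0 [-> h]]; exists u0; split=> //.
    by apply/lfunP=> v; rewrite transposeE inclE h.
  by move=> v; rewrite -h transposeE inclE.
split=> [[u0 [-> ->]]|->]; first by rewrite symplecticK.
by exists (w^-1%VF (transpose (incl D) alpha)); rewrite symplecticVK.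
Qed.

Lemma has_bivector_Lspace (V : vectType R) (E : {vspace cplx V})
    (eps : bilform (subvs_of E)) (D : {vspace V}) :
  two_form eps -> cplx_space D = (E :&: conj_space (@conjv _ V) E)%VS ->
  symplectic_form (im_form eps D) ->
  has_bivector (Lspace eps) (push_bivector (incl D) ((im_form eps D)^-1)%VF).
Proof.
move=> e0 DE sw; exists (Lspace (im_form eps D)); split.
  by exists E, eps, D.
by split; [apply/bivector_push/symplectic_bivector | apply: graph_of_Lspace].
Qed.

Lemma cplx_form_two_form (V : vectType R) (b : bilform V) :
  two_form b -> two_form (cplx_form b).
Proof.
move=> b0 z; rewrite cplx_formE !b0 (two_formC z.2 z.1 b0).
apply/eqP; rewrite eq_complex /=; apply/andP; split; apply/eqP.
  exact: (subrr (0 : R)).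
exact: (subrr (b z.1 z.2 : R)).
Qed.

Lemma cplx_form_real (V : vectType R) (b : bilform V) u v :
  cplx_form b (real_vec u) (real_vec v) = (b u v)%:C.
Proof.
rewrite cplx_formE /= !bilform0r bilform0l; apply/eqP; rewrite eq_complex /=.
by apply/andP; split; apply/eqP; [exact: (subr0 (b u v : R)) |
  exact: (addr0 (0 : R))].
Qed.

(** Here E is all of V^C, so D = V, and the imaginary part of i w on real vectors is w. *)
Lemma has_bivector_L_symplectic (V : vectType R) (w : bilform V) :
  symplectic_form w -> has_bivector (L_symplectic w) (w^-1)%VF.
Proof.
move=> sw; pose eps := restr_form fullv ('i *: cplx_form w)%R.
exists (Lspace (im_form eps fullv)); split.
  exists fullv, eps, fullv; split=> //.
    move=> u; rewrite restr_formE !scale_lfunE cplx_form_two_form ?scaler0 //.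
    by case: sw.
  apply/vspaceP => z; rewrite mem_cplx_space !memvf memv_cap memvf.
  by rewrite mem_conj_space ?memvf //; [exact: conjvK | exact: conjvP].
split; first exact: symplectic_bivector.
move=> u alpha; rewrite mem_LspaceE /=.
have -> : (u \in fullv /\ {in fullv, forall v, alpha v =
    im_form eps fullv (vsproj fullv u) (vsproj fullv v)}) <-> alpha = w u.
  have wE v : im_form eps fullv (vsproj fullv u) (vsproj fullv v) = w u v.
    rewrite im_formE !vsprojK ?memvf // restr_formE !vsprojK ?memvf //.
    rewrite !scale_lfunE cplx_form_real -complexiE /=.
    by rewrite mul0r mul1r add0r.
  split=> [[_ h]|->]; last by rewrite memvf; split=> // v _.
  by apply/lfunP=> v; rewrite h ?memvf ?wE.
by split=> [->|->]; rewrite ?symplecticK ?symplecticVK.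
Qed.

End Poisson.

(** * Structures split by a decomposition *)

Section NormalForm.
Variable R : realType.

Lemma real_vecP (V : vectType R) a (x y : V) :
  real_vec (a *: x + y) = a%:C *: real_vec x + real_vec y.
Proof.
congr pair => /=; first by rewrite scaler0 subr0.
by rewrite scaler0 scale0r !addr0.
Qed.

Lemma conjv_cplx_map (V W : vectType R) (f : 'Hom(V, W)) z :
  conjv (cplx_map f z) = cplx_map f (conjv z).
Proof. by rewrite !cplx_mapE /conjv /= linearN. Qed.

Lemma mem_conjv_space (V : vectType R) (E : {vspace cplx V}) z :
  (z \in conj_space (@conjv _ V) E) = (conjv z \in E).
Proof. by apply: mem_conj_space; [exact: conjvK | exact: conjvP]. Qed.

Lemma mem_B_transform (V : vectType R) (b : bilform V) L z beta :
  ((z, beta) \in B_transform b L) = ((z, beta - cplx_form b z) \in L).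
Proof.
apply/memv_imgP/idP => [[x xL]|h].
  by rewrite exp_formE => -[-> ->]; rewrite addrC addKr; case: x xL.
by exists (z, beta - cplx_form b z); rewrite // exp_formE /= addrC subrK.
Qed.

Lemma mem_L_symplectic (V : vectType R) (w : bilform V) u beta :
  (u, beta) \in L_symplectic w <->
  forall v, beta v = 'i * cplx_form w u v.
Proof.
rewrite mem_LspaceE /=.
have wE v : restr_form fullv ('i *: cplx_form w) (vsproj fullv u)
    (vsproj fullv v) = 'i * cplx_form w u v.
  by rewrite restr_formE !vsprojK ?memvf // !scale_lfunE.
split=> [[_ h] v|h]; first by rewrite h ?memvf // wE.
by rewrite memvf; split=> // v _; rewrite h wE.
Qed.

(** The space V^{1,0} on which [L_complex] is based. *)
Definition holo (V : vectType R) (J : 'End(V)) : {vspace cplx V} :=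
  passmx.leigenspace (cplx_map J) 'i.

(** J x + i J y = i (x + i y) amounts to y = - J x, the other equation following from J^2 = -1. *)
Lemma mem_holo (V : vectType R) (J : 'End(V)) z :
  complex_structure J -> (z \in holo J) = (z.2 == - J z.1).
Proof.
move=> JJ; rewrite /holo /passmx.leigenspace memv_ker.
rewrite add_lfunE opp_lfunE scale_lfunE id_lfunE cplx_mapE -complexiE.
rewrite cplx_scaleE /= !scale0r !scale1r sub0r add0r subr_eq0.
apply/eqP/eqP => [[-> _]|->]; first by rewrite opprK.
by rewrite opprK linearN /= JJ opprK.
Qed.

Lemma mem_L_complex (V : vectType R) (J : 'End(V)) u beta :
  (u, beta) \in L_complex J <->
  u \in holo J /\ {in holo J, forall v, beta v = 0}.
Proof.
rewrite mem_LspaceE /= -/(holo J).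
by split=> -[uJ h]; split=> // v vJ; rewrite h // !zero_lfunE.
Qed.

Section Split.
Variables (V : vectType R) (V1 V2 : {vspace V}).
Hypothesis dec : decomposition V1 V2.

Notation i1 := (cplx_map (incl V1)).
Notation i2 := (cplx_map (incl V2)).
Notation p1 := (cplx_map (dec_proj1 V1 V2)).
Notation p2 := (cplx_map (dec_proj2 V1 V2)).

Lemma cplx_incl_proj z : i1 (p1 z) + i2 (p2 z) = z.
Proof.
by rewrite !cplx_mapE; case: z => x y; congr pair; exact: incl_proj.
Qed.

Lemma cplx_proj_incl u1 u2 :
  p1 (i1 u1 + i2 u2) = u1 /\ p2 (i1 u1 + i2 u2) = u2.
Proof.
case: u1 u2 => [x1 y1] [x2 y2]; rewrite !cplx_mapE /=.
by have [-> ->] := proj_incl dec x1 x2; have [-> ->] := proj_incl dec y1 y2.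
Qed.

Lemma cplx_proj_incl1 u1 : p1 (i1 u1) = u1 /\ p2 (i1 u1) = 0.
Proof. by have := cplx_proj_incl u1 0; rewrite linear0 addr0. Qed.

Lemma cplx_proj_incl2 u2 : p1 (i2 u2) = 0 /\ p2 (i2 u2) = u2.
Proof. by have := cplx_proj_incl 0 u2; rewrite linear0 add0r. Qed.

Lemma mem_cplx_space_proj z : (z \in cplx_space V2) = (p1 z == 0).
Proof.
apply/idP/eqP => [|z0].
  rewrite mem_cplx_space => /andP[z1 z2].
  have -> : z = i2 (vsproj V2 z.1, vsproj V2 z.2).
    by rewrite cplx_mapE /= !inclE !vsprojK //; case: z {z1 z2}.
  by case: (cplx_proj_incl2 (vsproj V2 z.1, vsproj V2 z.2)).
rewrite -(cplx_incl_proj z) z0 linear0 add0r mem_cplx_space cplx_mapE /=.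
by rewrite !inclE !subvsP.
Qed.

Section OfDirectSum.
Variables (b : bilform V) (J : 'End(subvs_of V1)) (w : bilform (subvs_of V2)).
Variables (E : {vspace cplx V}) (eps : bilform (subvs_of E)).
Hypothesis JJ : complex_structure J.
Hypothesis sum :
  direct_sum (B_transform b (Lspace eps)) (L_complex J) (L_symplectic w).

(** A B-field does not change vector components, so E is the base of the direct sum, V1^{1,0} +
    V2^C. *)
Lemma normal_form_mem z : (z \in E) = (p1 z \in holo J).
Proof.
apply/idP/idP => [/(Lspace_proj eps)[alpha aL]|zJ].
  case: sum => _ /(_ (p1 z) (p2 z) (cplx_form b z + alpha)).
  rewrite cplx_incl_proj mem_B_transform addrC addKr aL.
  by move/esym/andP => [/mem_L_complex[]].
(* A covector over z in the direct sum: zero on V1^C and i w (p2 z) on V2^C. Subtracting the B-field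
   term brings it back to L. *)
pose alpha : dual (cplx V) := (('i *: cplx_form w (p2 z)) \o p2)%VF.
apply/(Lspace_proj eps); exists (alpha - cplx_form b z).
rewrite -mem_B_transform -[X in (X, _)]cplx_incl_proj.
case: sum => _ ->; apply/andP; split.
  apply/mem_L_complex; split=> // v _.
  by rewrite transposeE comp_lfunE (cplx_proj_incl1 v).2 linear0.
apply/mem_L_symplectic => v.
by rewrite transposeE comp_lfunE (cplx_proj_incl2 v).2 scale_lfunE.
Qed.

(** Only V1-components matter: x + i y and its conjugate are both holomorphic only if J x = - J x,
    so x = y = 0. *)
Lemma normal_form_real : cplx_space V2 = (E :&: conj_space (@conjv _ V) E)%VS.
Proof.
apply/vspaceP => z; rewrite mem_cplx_space_proj memv_cap mem_conjv_space.
rewrite !normal_form_mem -conjv_cplx_map !mem_holo //=.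
case: (p1 z) => x y /=; apply/eqP/andP => [[-> ->]|[/eqP-> /eqP]].
  by rewrite linear0 oppr0.
move/oppr_inj => e; have x0 : J x = 0.
  have e2 : J x *+ 2 = 0 by rewrite mulr2n -{1}e addNr.
  apply/eqP; have : (2%:R : R) *: J x == 0 by rewrite scaler_nat e2.
  by rewrite scaler_eq0 pnatr_eq0.
have -> : x = 0 by apply: oppr_inj; rewrite -JJ x0 linear0 oppr0.
by rewrite linear0 oppr0.
Qed.

(** On V2 the transformed form eps + b is i w, and the real form b does not affect imaginary parts
    at real vectors. *)
Lemma normal_form_im : im_form eps V2 = w.
Proof.
apply/lfunP=> u; apply/lfunP=> v; rewrite im_formE.
set x := real_vec (vsval u); set y := real_vec (vsval v).
have realE (t : subvs_of V2) : real_vec (vsval t) = i2 (real_vec t).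
  by rewrite cplx_mapE /= !inclE linear0.
have inE (t : subvs_of V2) : real_vec (vsval t) \in E.
  by rewrite normal_form_mem realE (cplx_proj_incl2 _).1 mem0v.
have [alpha aL] := (Lspace_proj eps x).1 (inE u).
have /mem_LspaceE[_ /(_ y (inE v)) <-] := aL.
case: sum => _ /(_ 0 (real_vec u) (cplx_form b x + alpha)).
rewrite linear0 add0r -realE mem_B_transform addrC addKr aL.
move/esym/andP => [_ /mem_L_symplectic/(_ (real_vec v))].
rewrite transposeE -realE add_lfunE !cplx_form_real -complexiE.
move/(congr1 (@complex.Im _)) => /=; case: (alpha y) => c d /=.
by rewrite add0r mul0r mul1r add0r.
Qed.

End OfDirectSum.
End Split.
End NormalForm.

(** * The complex structure transverse to D *)

Section Construction.
Variable R : realType.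

(** Otherwise a nonzero alpha vanishes on E and on conj E, and (0, alpha) lies in L and in its
    conjugate. *)
Lemma coCR_total (V : vectType R) (E : {vspace cplx V})
    (eps : bilform (subvs_of E)) :
  generalized_complex (Lspace eps) ->
  (E + conj_space (@conjv _ V) E)%VS = fullv.
Proof.
move=> [_ L0]; apply/eqP; rewrite eqEsubv subvf; apply/subvP => z _.
apply/negPn/negP => /exists_functional[alpha [az a0]].
have aE : {in E, forall v, alpha v = 0}.
  by move=> v vE; apply: a0; rewrite (subvP (addvSl _ _)).
have aEc v : v \in E -> alpha (conjv v) = 0.
  move=> vE; apply: a0; apply: (subvP (addvSr _ _)).
  by rewrite mem_conjv_space conjvK.
have inL (beta : dual (cplx V)) : {in E, forall v, beta v = 0} ->
    ((0, beta) : gen (cplx V)) \in Lspace eps.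
  move=> b0; apply/mem_LspaceE; rewrite mem0v; split=> // v vE /=.
  by rewrite b0 // linear0 bilform0l.
have : ((0, alpha) : gen (cplx V)) \in
    (Lspace eps :&: conj_space (@conj_gen _ V) (Lspace eps))%VS.
  rewrite memv_cap inL // mem_conj_space; [|exact: conj_genK|exact: conj_genP].
  have -> : conj_gen ((0, alpha) : gen (cplx V)) = (0, conj_dual alpha).
    by rewrite /conj_gen /= /conjv /= oppr0.
  by apply: inL => v vE; rewrite conj_dualE aEc // conjc0.
by rewrite L0 memv0 => /eqP[a00]; rewrite a00 lfunE eqxx in az.
Qed.

Section ComplexStructure.
Variables (V : vectType R) (E : {vspace cplx V}) (V1 D : {vspace V}).
Hypothesis dec : decomposition V1 D.
Hypothesis total : (E + conj_space (@conjv _ V) E)%VS = fullv.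
Hypothesis DE : cplx_space D = (E :&: conj_space (@conjv _ V) E)%VS.

Lemma real_subspaceE v : (v \in D) = (real_vec v \in E).
Proof.
have := mem_cplx_space D (real_vec v); rewrite DE memv_cap mem_conjv_space /=.
by rewrite /conjv /= oppr0 mem0v andbT andbb.
Qed.

Lemma cplx_space_sub z : z \in cplx_space D -> z \in E.
Proof. by rewrite DE memv_cap => /andP[]. Qed.

(* For v in V1 write v = z + y with z in E and y in conj E; then
   z + conj y = v - i x lies in E with x = - 2 Im z, and J v is the
   V1-component of x. *)
Definition coCR_J_fun (v : subvs_of V1) : subvs_of V1 :=
  dec_proj1 V1 D (- 2 *: (addv_pi1 E (conj_space (@conjv _ V) E)
    (real_vec (vsval v))).2).

Definition coCR_J : 'End(subvs_of V1) := linfun coCR_J_fun.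

Lemma coCR_JE v : coCR_J v = coCR_J_fun v.
Proof.
apply: linfun_linE => a x y; rewrite /coCR_J_fun.
have -> : real_vec (vsval (a *: x + y)) =
    a%:C *: real_vec (vsval x) + real_vec (vsval y) by exact: real_vecP.
rewrite linearP /= scale0r addr0 -[RHS]linearP. congr (dec_proj1 V1 D _).
by rewrite scalerDr !scalerA mulrC.
Qed.

Lemma coCR_J_mem v : (vsval v, - vsval (coCR_J v)) \in E.
Proof.
rewrite coCR_JE /coCR_J_fun; set z := addv_pi1 _ _ _.
have zE : z \in E by exact: memv_pi1.
have := @addv_pi1_pi2 _ _ E (conj_space (@conjv _ V) E) (real_vec (vsval v)).
rewrite total memvf -/z => /(_ isT); set y := addv_pi2 _ _ _ => zy.
have : y \in conj_space (@conjv _ V) E by exact: memv_pi2.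
rewrite mem_conjv_space => yE.
set x := - 2 *: z.2.
(* Since v = z + y is real, the imaginary parts of z and y are opposite. *)
have e : ((vsval v, - x) : cplx V) = z + conjv y.
  congr pair; first by rewrite -[RHS]/((z + y).1) zy.
  rewrite -[RHS]/(z.2 - y.2) /x scaleNr opprK scaler_nat mulr2n; congr (_ + _).
  by apply/eqP; rewrite -addr_eq0 -[_ + _]/((z + y).2) zy.
(* Dropping the D-component of x changes the vector by an element of D^C, which is contained in
   E. *)
have -> : ((vsval v, - vsval (dec_proj1 V1 D x)) : cplx V) =
    ((vsval v, - x) : cplx V) + ((0, vsval (dec_proj2 V1 D x)) : cplx V).
  congr pair; first by rewrite addr0.
  have := incl_proj dec x; rewrite !inclE => xE.
  by rewrite /= -{2}xE opprD addrNK.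
apply: (@memvD _ _ E); first by rewrite e; apply: memvD.
by apply: cplx_space_sub; rewrite mem_cplx_space /= mem0v subvsP.
Qed.

(** The difference of the two vectors, multiplied by i, is a real vector of E; so y - y' lies in D
    as well as in V1. *)
Lemma imag_mem_unique (x y y' : subvs_of V1) :
  ((vsval x, vsval y) : cplx V) \in E -> ((vsval x, vsval y') : cplx V) \in E ->
  y = y'.
Proof.
move=> xy xy'; apply/subr0_eq/subvs_inj; rewrite linear0; apply/eqP.
case: dec => _ d0; rewrite -memv0 -d0 memv_cap subvsP real_subspaceE.
have := memvZ ('i)%C (memvB xy' xy); rewrite cplx_scaleE /=.
by rewrite !scale0r !scale1r sub0r add0r subrr opprB.
Qed.

(** E contains i (v - i J v) = J v + i v and also J v - i J (J v); their imaginary parts agree by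
    uniqueness. *)
Lemma coCR_J_structure : complex_structure coCR_J.
Proof.
move=> v; apply: oppr_inj; rewrite opprK.
have := memvZ ('i)%C (coCR_J_mem v); rewrite cplx_scaleE /=.
rewrite !scale0r !scale1r sub0r add0r opprK => h.
apply: (@imag_mem_unique (coCR_J v)) => //.
by rewrite linearN /=; exact: coCR_J_mem.
Qed.

Notation i1 := (cplx_map (incl V1)).
Notation i2 := (cplx_map (incl D)).
Notation p1 := (cplx_map (dec_proj1 V1 D)).
Notation p2 := (cplx_map (dec_proj2 V1 D)).

(** As D^C lies in E, only the V1-component of z matters, and there [imag_mem_unique] forces the
    form x - i J x. *)
Lemma coCR_mem z : (z \in E) = (p1 z \in holo coCR_J).
Proof.
rewrite mem_holo; last exact: coCR_J_structure.
have dE : i2 (p2 z) \in E.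
  apply: cplx_space_sub; rewrite (mem_cplx_space_proj dec).
  by rewrite (cplx_proj_incl2 dec _).1.
have -> : (z \in E) = (i1 (p1 z) \in E).
  by rewrite -{1}(cplx_incl_proj dec z) rpredDr.
case: (p1 z) => x y; rewrite cplx_mapE /= !inclE.
apply/idP/eqP => [h|->]; last by rewrite linearN; exact: coCR_J_mem.
by apply: imag_mem_unique h _; rewrite linearN; exact: coCR_J_mem.
Qed.

End ComplexStructure.
End Construction.

(** * The B-field *)

Section BField.

(** Extends eps along the projection [vsproj E], so that it can be pulled back by endomorphisms of
    U. *)
Definition ext_form (K : fieldType) (U : vectType K) (E : {vspace U})
    (eps : bilform (subvs_of E)) : bilform U :=
  bilform_of (fun u v => eps (vsproj E u) (vsproj E v)).

Lemma ext_formE (K : fieldType) (U : vectType K) (E : {vspace U})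
    (eps : bilform (subvs_of E)) u v :
  ext_form eps u v = eps (vsproj E u) (vsproj E v).
Proof.
rewrite bilform_ofE // => a x y z; first by rewrite linearP bilformDZl.
by rewrite linearP bilformDZr.
Qed.

Definition pull_form (K : fieldType) (U : vectType K) (h : 'End(U))
    (b : bilform U) : bilform U :=
  bilform_of (fun u v => b (h u) (h v)).

Lemma pull_formE (K : fieldType) (U : vectType K) (h : 'End(U))
    (b : bilform U) u v :
  pull_form h b u v = b (h u) (h v).
Proof.
rewrite bilform_ofE // => a x y z; first by rewrite linearP bilformDZl.
by rewrite linearP bilformDZr.
Qed.

Variable R : realType.

Definition re_form (V : vectType R) (F : bilform (cplx V)) : bilform V :=
  bilform_of (fun x y => complex.Re (F (real_vec x) (real_vec y))).

Lemma re_formE (V : vectType R) (F : bilform (cplx V)) x y :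
  re_form F x y = complex.Re (F (real_vec x) (real_vec y)).
Proof.
have ReP a (c d : R[i]) :
    complex.Re (a%:C * c + d) = a * complex.Re c + complex.Re d.
  by case: c d => [c c'] [d d'] /=; rewrite mul0r subr0.
rewrite bilform_ofE // => a u v z; rewrite real_vecP -ReP.
  by rewrite bilformDZl.
by rewrite bilformDZr.
Qed.

Lemma cplxE (V : vectType R) (z : cplx V) :
  z = ('i)%C *: real_vec z.2 + real_vec z.1.
Proof.
case: z => x y; congr pair => /=.
  by rewrite scale0r scaler0 subrr add0r.
by rewrite scale1r scaler0 add0r addr0.
Qed.

(** Taking real parts on V and complexifying again averages F with its conjugate form. *)
Lemma cplx_re_form (V : vectType R) (F : bilform (cplx V)) z z' :
  cplx_form (re_form F) z z' =
  2^-1 * (F z z' + conjc (F (conjv z) (conjv z'))).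
Proof.
rewrite cplx_formE !re_formE.
have FE (u v : cplx V) : F u v =
    F (real_vec u.1) (real_vec v.1) - F (real_vec u.2) (real_vec v.2) +
    ('i)%C * (F (real_vec u.1) (real_vec v.2) +
      F (real_vec u.2) (real_vec v.1)).
  rewrite {1}(cplxE u) bilformDZl {1 2}(cplxE v) !bilformDZr.
  by rewrite mulrDr mulrA -expr2 sqr_i; ring.
have realN (u : V) : real_vec (- u) = (-1) *: real_vec u + 0.
  by rewrite addr0 scaleN1r; congr pair; rewrite /= oppr0.
rewrite (FE z z') (FE (conjv z)) /= !realN !(bilformDZl, bilformDZr).
rewrite !(bilform0l, bilform0r).
(* Both sides now involve only four values of F at real vectors, which may be arbitrary complex
   numbers. *)
move: (F _ _) (F _ _) (F _ _) (F _ _) => [a a'] [b b'] [c c'] [d d'].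
apply: (@mulfI _ 2); first by rewrite pnatr_eq0.
rewrite mulVKf ?pnatr_eq0 //.
by apply/eqP; rewrite eq_complex /=; apply/andP; split; apply/eqP; ring.
Qed.

End BField.

(** * Existence of the splitting up to a B-field *)

Section Existence.
Variables (R : realType) (V : vectType R).
Variables (E : {vspace cplx V}) (eps : bilform (subvs_of E)).
Variables (V1 D : {vspace V}).
Hypothesis eps0 : two_form eps.
Hypothesis dec : decomposition V1 D.
Hypothesis total : (E + conj_space (@conjv _ V) E)%VS = fullv.
Hypothesis DE : cplx_space D = (E :&: conj_space (@conjv _ V) E)%VS.

Notation w := (im_form eps D).
Notation i1 := (cplx_map (incl V1)).
Notation i2 := (cplx_map (incl D)).
Notation p1 := (cplx_map (dec_proj1 V1 D)).
Notation p2 := (cplx_map (dec_proj2 V1 D)).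

(** The space V1^{0,1} of the transverse complex structure, as a subspace of V^C. *)
Definition antiholo : {vspace cplx V} :=
  (conj_space (@conjv _ V) E :&: cplx_space V1)%VS.

(* The projection S onto E along antiholo fixes E and agrees on conj E with the
   projection Q onto D^C. Hence the complexification of
   Re (eps (Q x, Q y) - 2 eps (S x, S y)) restricts to i w - eps on E. *)
Definition Bfield : bilform V :=
  re_form (pull_form (i2 \o p2)%VF (ext_form eps)
           - 2 *: pull_form (daddv_pi E antiholo) (ext_form eps)).

Lemma Bfield_two_form : two_form Bfield.
Proof.
move=> x; rewrite re_formE add_lfunE opp_lfunE scale_lfunE.
rewrite add_lfunE opp_lfunE scale_lfunE !pull_formE !ext_formE !eps0.
by rewrite scaler0 subr0.
Qed.

Lemma mem_i2 u : i2 u \in cplx_space D.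
Proof. by rewrite (mem_cplx_space_proj dec) (cplx_proj_incl2 dec u).1. Qed.

Lemma mem_i2E u : i2 u \in E.
Proof. exact: cplx_space_sub DE _ (mem_i2 u). Qed.

(** The intersection is that of D^C with V1^C. *)
Lemma antiholo_cap : (E :&: antiholo = 0)%VS.
Proof.
rewrite capvA -DE; apply/eqP; rewrite -subv0; apply/subvP => z.
rewrite memv_cap (mem_cplx_space_proj dec) => /andP[/eqP z1 zV1].
rewrite -(cplx_incl_proj dec z) z1 linear0 add0r.
have -> : z = i1 (vsproj V1 z.1, vsproj V1 z.2).
  move: zV1; rewrite mem_cplx_space cplx_mapE /= !inclE => /andP[h h'].
  by rewrite !vsprojK //; case: (z).
by rewrite (cplx_proj_incl1 dec _).2 linear0 mem0v.
Qed.

Lemma Bfield_proj_conj z :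
  z \in E -> daddv_pi E antiholo (conjv z) = i2 (p2 (conjv z)).
Proof.
move=> zE; rewrite -{1}(cplx_incl_proj dec (conjv z)) linearD /=.
rewrite (daddv_pi_id antiholo_cap (mem_i2E _)).
(* The V1-component of conj z is conj z minus an element of D^C, hence stays in conj E; the
   projection along [antiholo] then kills it. *)
have tT : i1 (p1 (conjv z)) \in antiholo.
  rewrite memv_cap; apply/andP; split; last first.
    by rewrite mem_cplx_space cplx_mapE /= !inclE !subvsP.
  rewrite mem_conjv_space -(addrK (i2 (p2 (conjv z))) (i1 _)).
  rewrite cplx_incl_proj // -scaleN1r addrC conjvP conjvK memvD //.
  by rewrite memvZ // !conjv_cplx_map conjvK mem_i2E.
have cap' : (antiholo :&: E = 0)%VS by rewrite capvC antiholo_cap.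
have := @daddv_pi_add _ _ E antiholo (i1 (p1 (conjv z))) antiholo_cap.
rewrite (daddv_pi_id cap' tT) (subvP (addvSr _ _)) // => /(_ isT) /eqP.
by rewrite eq_sym -subr_eq subrr => /eqP <-; rewrite add0r.
Qed.

(** Apply [cplx_re_form] to - i eps, whose real part is the imaginary part of eps. *)
Lemma cplx_im_form u v : 'i * cplx_form w u v =
  2^-1 * (ext_form eps (i2 u) (i2 v) -
          conjc (ext_form eps (conjv (i2 u)) (conjv (i2 v)))).
Proof.
have wE x y :
    w x y = re_form (- ('i)%C *: ext_form eps) (vsval x) (vsval y).
  rewrite im_formE re_formE !scale_lfunE ext_formE.
  by case: (eps _ _) => a b /=; rewrite oppr0 mul0r mulN1r opprK add0r.
have -> : cplx_form w u v =
    cplx_form (re_form (- ('i)%C *: ext_form eps)) (i2 u) (i2 v).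
  by rewrite !cplx_formE !wE !cplx_mapE /= !inclE.
rewrite cplx_re_form !scale_lfunE mulrCA; congr (_ * _).
rewrite -complexiE.
case: (ext_form eps _ _) (ext_form eps _ _) => [a a'] [b b'].
by apply/eqP; rewrite eq_complex /=; apply/andP; split; apply/eqP; ring.
Qed.

(** Put X = eps (Q z, Q z'), T = eps (z, z') and Y = eps (Q conj z, Q conj z'). As S is the identity
    on E and equals Q on conj E, averaging gives (X - 2 T + conj (Y - 2 Y)) / 2 = (X - conj Y) / 2 -
    T, and the first term is i w. *)
Lemma Bfield_mem z z' : z \in E -> z' \in E ->
  cplx_form Bfield z z' =
  'i * cplx_form w (p2 z) (p2 z') - eps (vsproj E z) (vsproj E z').
Proof.
move=> zE z'E; rewrite cplx_re_form cplx_im_form.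
rewrite !(add_lfunE, opp_lfunE, scale_lfunE) !pull_formE !Bfield_proj_conj //.
rewrite !daddv_pi_id ?antiholo_cap // !comp_lfunE -!conjv_cplx_map.
rewrite -(ext_formE eps z z').
move: (ext_form eps _ _) (ext_form eps _ _) (ext_form eps _ _) => x y t.
apply: (@mulfI _ 2); first by rewrite pnatr_eq0.
rewrite mulrBr !mulVKf ?pnatr_eq0 //.
rewrite -![_ *: _]/(_ * _); case: x y t => [a a'] [b b'] [c c'].
by apply/eqP; rewrite eq_complex /=; apply/andP; split; apply/eqP; ring.
Qed.

(** After the B-field, the covectors over z restrict on E to i w (p2 z, p2 .). Since E is the sum of
    the holomorphic space and D^C, this splits into vanishing on the former and being i w on the
    latter. *)
Lemma normal_form_exists :
  direct_sum (B_transform Bfield (Lspace eps))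
    (L_complex (coCR_J E V1 D)) (L_symplectic w).
Proof.
split=> // u1 u2 alpha; set J := coCR_J E V1 D.
have memE z : (z \in E) = (p1 z \in holo J) by exact: coCR_mem.
have [pz1 pz2] := cplx_proj_incl dec u1 u2.
set z := _ + _ in pz1 pz2 *.
rewrite mem_B_transform; apply/idP/andP.
  move=> /mem_LspaceE /= [zE h].
  have {}h z' : z' \in E -> alpha z' = 'i * cplx_form w u2 (p2 z').
    move=> z'E; have := h _ z'E; rewrite add_lfunE opp_lfunE Bfield_mem // pz2.
    by move/eqP; rewrite subr_eq addrC subrK => /eqP.
  split.
    apply/mem_L_complex; split=> [|v vJ]; first by rewrite -pz1 -memE.
    have [v1 v2] := cplx_proj_incl1 dec v.
    by rewrite transposeE h ?memE ?v1 // v2 bilform0r mulr0.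
  apply/mem_L_symplectic => v; have [_ v2] := cplx_proj_incl2 dec v.
  by rewrite transposeE h ?mem_i2E // v2.
move=> [/mem_L_complex[u1J h1] /mem_L_symplectic h2].
have zE : z \in E by rewrite memE pz1.
apply/mem_LspaceE; split=> //= z' z'E.
rewrite add_lfunE opp_lfunE Bfield_mem // pz2.
rewrite -{1}(cplx_incl_proj dec z') linearD /= -!(transposeE _ alpha) h2.
by rewrite h1 -?memE // add0r opprB addrCA subrr addr0.
Qed.

End Existence.

(** If w u = 0 then (u, 0) lies in the graph of pi, so u = pi 0 = 0. *)
Lemma symplectic_of_graph (R : realType) (V : vectType R) (D : {vspace V})
    (w : bilform (subvs_of D)) pi :
  two_form w -> graph_of (Lspace w) pi -> symplectic_form w.
Proof.
move=> w0 gw; split=> // u u0; apply: subvs_inj; rewrite linear0.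
suff /gw -> : ((vsval u, 0) : gen V) \in Lspace w by rewrite linear0.
apply/mem_LspaceE; rewrite subvsP; split=> // v _ /=.
by rewrite zero_lfunE vsvalK u0.
Qed.

(** * Direct sums of linear maps *)

Section DirectSumMap.
Variables (R : realType) (V W : vectType R) (f : 'Hom(V, W)).
Variables (V1 V2 : {vspace V}) (W1 W2 : {vspace W}).
Variables (f1 : 'Hom(subvs_of V1, subvs_of W1)).
Variables (f2 : 'Hom(subvs_of V2, subvs_of W2)).
Hypothesis fsum : direct_sum_map f f1 f2.

Lemma direct_sum_map2 : (f \o incl V2 = incl W2 \o f2)%VF.
Proof.
apply/lfunP=> u; rewrite !comp_lfunE !inclE.
by have := fsum 0 u; rewrite !linear0 !add0r.
Qed.

Lemma cplx_direct_sum_map u1 u2 :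
  cplx_map f (cplx_map (incl V1) u1 + cplx_map (incl V2) u2) =
  cplx_map (incl W1) (cplx_map f1 u1) + cplx_map (incl W2) (cplx_map f2 u2).
Proof. by rewrite !cplx_mapE /= !inclE; congr pair; exact: fsum. Qed.

Hypotheses (decV : decomposition V1 V2) (decW : decomposition W1 W2).

(** Modulo V2^C, E consists of the vectors x - i J x; f sends one to f1 x - i f1 (J x), which is
    holomorphic exactly when f1 (J x) = J (f1 x). *)
Lemma direct_sum_map_holo (JV : 'End(subvs_of V1)) (JW : 'End(subvs_of W1))
    (EV : {vspace cplx V}) (EW : {vspace cplx W}) :
  complex_structure JV -> complex_structure JW ->
  (forall z, (z \in EV) = (cplx_map (dec_proj1 V1 V2) z \in holo JV)) ->
  (forall z, (z \in EW) = (cplx_map (dec_proj1 W1 W2) z \in holo JW)) ->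
  coCR_linear f EV EW <-> complex_linear JV JW f1.
Proof.
move=> JJV JJW EVE EWE; split=> [fE v|fJ].
  pose z : cplx (subvs_of V1) := (v, - JV v).
  have zE : cplx_map (incl V1) z \in EV.
    by rewrite EVE (cplx_proj_incl1 decV z).1 mem_holo.
  have := subvP fE _ (memv_img (cplx_map f) zE).
  rewrite -[cplx_map _ z]addr0 -(linear0 (cplx_map (incl V2))).
  rewrite cplx_direct_sum_map EWE (cplx_proj_incl decW _ _).1 mem_holo //.
  by rewrite cplx_mapE /= linearN eqr_opp => /eqP.
apply/subvP => _ /memv_imgP[z zE ->]; move: zE; rewrite EVE.
rewrite -{2}(cplx_incl_proj decV z) cplx_direct_sum_map EWE.
rewrite (cplx_proj_incl decW _ _).1 !mem_holo //.
by case: (cplx_map _ z) => x y /= /eqP ->; rewrite cplx_mapE /= linearN /= fJ.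
Qed.

Lemma direct_sum_map_bivector (wV : bilform (subvs_of V2))
    (wW : bilform (subvs_of W2)) :
  push_bivector f (push_bivector (incl V2) (wV^-1)%VF) =
    push_bivector (incl W2) (wW^-1)%VF <->
  push_bivector f2 (wV^-1)%VF = (wW^-1)%VF.
Proof.
rewrite -push_bivector_comp direct_sum_map2 push_bivector_comp.
by split=> [/push_incl_inj //|->].
Qed.

End DirectSumMap.

(** * The equivalence of the two assertions *)

Theorem proposition3p2 (R : realType) (V W : vectType R) (f : 'Hom(V, W))
    (LV : {vspace gen (cplx V)}) (LW : {vspace gen (cplx W)}) :
  generalized_complex LV -> generalized_complex LW ->
  (generalized_complex_linear f LV LW <->
   exists (bV : bilform V) (bW : bilform W)
     (V1 V2 : {vspace V}) (W1 W2 : {vspace W})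
     (JV : 'End(subvs_of V1)) (JW : 'End(subvs_of W1))
     (wV : bilform (subvs_of V2)) (wW : bilform (subvs_of W2))
     (f1 : 'Hom(subvs_of V1, subvs_of W1))
     (f2 : 'Hom(subvs_of V2, subvs_of W2)),
     [/\ two_form bV /\ two_form bW,
         complex_structure JV /\ complex_structure JW
       & symplectic_form wV /\ symplectic_form wW] /\
     [/\ direct_sum (B_transform bV LV) (L_complex JV) (L_symplectic wV),
         direct_sum (B_transform bW LW) (L_complex JW) (L_symplectic wW),
         direct_sum_map f f1 f2,
         complex_linear JV JW f1
       & gen_Poisson_morphism f2 (L_symplectic wV) (L_symplectic wW)]).
Proof.
move=> gV gW; split; last first.
  (* From (ii) to (i): the splitting determines E, D and w on both sides, so each condition on f
     reduces to one on f1 or f2. *)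
  move=> [bV [bW [V1 [V2 [W1 [W2 [JV [JW [wV [wW [f1 [f2]]]]]]]]]]]].
  move=> [[_ [JJV JJW] [sV sW]] [sumV sumW fsum f1J Pf2]].
  have two0 : 2%:R != 0 :> R[i] by rewrite pnatr_eq0.
  have [EV [epsV [eV0 LVE]]] := maximal_isotropicE two0 gV.1.
  have [EW [epsW [eW0 LWE]]] := maximal_isotropicE two0 gW.1.
  subst LV LW; have [decV _] := sumV; have [decW _] := sumW.
  have wVE := normal_form_im decV sumV; have wWE := normal_form_im decW sumW.
  split.
    exists EV, EW; split; [by exists epsV | by exists epsW |].
    have VE := normal_form_mem decV sumV; have WE := normal_form_mem decW sumW.
    exact/(direct_sum_map_holo fsum decV decW JJV JJW VE WE).
  have hV :=
    @has_bivector_Lspace _ _ _ epsV V2 eV0 (normal_form_real decV JJV sumV).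
  have hW :=
    @has_bivector_Lspace _ _ _ epsW W2 eW0 (normal_form_real decW JJW sumW).
  rewrite wVE in hV; rewrite wWE in hW.
  apply/(gen_Poisson_morphismE f (hV sV) (hW sW)).
  apply/(direct_sum_map_bivector fsum).
  have h2V := has_bivector_L_symplectic sV.
  have h2W := has_bivector_L_symplectic sW.
  exact/(gen_Poisson_morphismE f2 h2V h2W).
move=> [[EV' [EW' [[epsV' [_ LV']] [epsW' [_ LW']] fE]]] [PV [PW [aV aW Pm]]]].
have Pf : gen_Poisson_morphism f LV LW by exists PV, PW.
case: Pm aV aW => piV [piW [[_ grV] [_ grW] pf]].
case=> EV [epsV [DV [eV0 LVE DVE PVE]]].
case=> EW [epsW [DW [eW0 LWE DWE PWE]]].
(* The co-CR and the Poisson condition each supply a base of L; they coincide. *)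
have eV : EV' = EV by exact: Lspace_inj_base (etrans (esym LV') LVE).
have eW : EW' = EW by exact: Lspace_inj_base (etrans (esym LW') LWE).
rewrite {}eV {}eW {epsV' epsW' LV' LW'} in fE; subst LV LW PV PW.
have sV := symplectic_of_graph (im_form_two_form (D := DV) eV0) grV.
have sW := symplectic_of_graph (im_form_two_form (D := DW) eW0) grW.
have totV := coCR_total gV; have totW := coCR_total gW.
(* W1 is an arbitrary complement of DW; V1 is a complement, inside the preimage of W1, of the part
   of that preimage lying in DV. *)
pose W1 : {vspace W} := (DW^C)%VS.
pose V1 : {vspace V} := (f @^-1: W1 :\: DV)%VS.
have decW : decomposition W1 DW.
  by split; [rewrite addvC addv_complf | rewrite capvC capv_compl].
have fD v : v \in DV -> f v \in DW.
  rewrite (real_subspaceE DVE) (real_subspaceE DWE).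
  move/(memv_img (cplx_map f))/(subvP fE).
  by rewrite cplx_mapE /= linear0.
(* Each d in DW is piW alpha for some alpha, which is f applied to piV (transpose f alpha), and the
   image of piV lies in DV. *)
have fDW d : d \in DW -> exists2 v, v \in DV & f v = d.
  move=> /(Lspace_proj (im_form epsW DW))[alpha /grW ->].
  rewrite -pf /push_bivector !comp_lfunE; set beta := transpose f alpha.
  exists (piV beta) => //; apply/(Lspace_proj (im_form epsV DV)).
  by exists beta; apply/grV.
have decV : decomposition V1 DV.
  split; last exact: capv_diff.
  apply/eqP; rewrite addv_diff eqEsubv subvf; apply/subvP => v _.
  have := memvf (f v); case: decW => <- _ /memv_addP[x xW [d /fDW[u uD ud] e]].
  (* Write f v = x + f u with x in W1 and u in DV; then v - u lies in the preimage of W1. *)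
  rewrite -(subrK u v) memv_add // -memv_preim linearB /= e ud addrK //.
have fV1 v : v \in V1 -> f v \in W1.
  by move/(subvP (diffvSl _ _)); rewrite -memv_preim.
pose f1 : 'Hom(subvs_of V1, subvs_of W1) :=
  (linfun (vsproj W1) \o (f \o incl V1))%VF.
pose f2 : 'Hom(subvs_of DV, subvs_of DW) :=
  (linfun (vsproj DW) \o (f \o incl DV))%VF.
have fsum : direct_sum_map f f1 f2.
  move=> u1 u2; rewrite !comp_lfunE !inclE !lfunE /= !vsprojK ?linearD //.
    exact/fD/subvsP.
  exact/fV1/subvsP.
have JJV := coCR_J_structure decV totV DVE.
have JJW := coCR_J_structure decW totW DWE.
exists (Bfield epsV V1 DV), (Bfield epsW W1 DW), V1, DV, W1, DW.
exists (coCR_J EV V1 DV), (coCR_J EW W1 DW).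
exists (im_form epsV DV), (im_form epsW DW).
exists f1, f2; split; first by split=> //; split; exact: Bfield_two_form.
split=> //; try exact: normal_form_exists.
  have VE := coCR_mem decV totV DVE; have WE := coCR_mem decW totW DWE.
  exact/(direct_sum_map_holo fsum decV decW JJV JJW VE WE).
have hV := has_bivector_Lspace eV0 DVE sV.
have hW := has_bivector_Lspace eW0 DWE sW.
have h2V := has_bivector_L_symplectic sV.
have h2W := has_bivector_L_symplectic sW.
apply/(gen_Poisson_morphismE f2 h2V h2W).
by apply/(direct_sum_map_bivector fsum); apply/(gen_Poisson_morphismE f hV hW).
Qed.
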